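(* Let $n$ be a positive integer. The complete graph $K_{n+1}$ on $n+1$ vertices does not possess strict $n$-convexity; that is, for no weight function $w:V(K_{n+1})\to\mathbb{R}_+$ is the weighted graph $K_{n+1}$ with weights $w$ strictly $n$-convex.
   Context: $\mathbb{R}_+=[0,\infty)$. A weighted graph $G(V,E,w)$ is a simple connected graph with vertex set $V$ and edge set $E$ together with a weight function $w:V\to\mathbb{R}_+$. For a positive integer $n$, $G(V,E,w)$ is called strictly $n$-convex if for every vertex $v\in V$ having at least $n$ adjacent vertices, and for every choice of $n$ distinct vertices $v_1,\dots,v_n$ adjacent to $v$, one has $n\cdot w(v)<w(v_1)+\cdots+w(v_n)$. *)

(* Defs.v *)
From mathcomp Require Import all_boot all_order all_algebra.
From mathcomp Require Import reals.

Set Implicit Arguments.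
Unset Strict Implicit.
Unset Printing Implicit Defensive.

Import Order.TTheory GRing.Theory Num.Theory.
Local Open Scope ring_scope.

(* The edge set is given by its adjacency relation; the vertex set is not
   required to be finite. *)
Record sgraph := SGraph {
  vertex :> eqType;
  adj : rel vertex;
  adj_sym : symmetric adj;
  adj_irrefl : irreflexive adj;
  adj_connected :
    forall x y : vertex, exists2 p : seq vertex, path adj x p & y = last x p
}.

Record wgraph (R : realType) := WGraph {
  graph :> sgraph;
  weight : graph -> R;
  weight_ge0 : forall v : graph, 0 <= weight v
}.

Definition has_at_least_neighbours (n : nat) (G : sgraph) (v : G) : Prop :=
  exists2 s : seq G, uniq s && all (adj v) s & (n <= size s)%N.

Definition strictly_convex (R : realType) (n : nat) (G : wgraph R) : Prop :=
  forall v : G, has_at_least_neighbours n v ->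
  forall s : n.-tuple G, uniq s -> all (adj v) s ->
    n%:R * weight v < \sum_(u <- s) weight u.

Definition complete_adj (m : nat) : rel 'I_m := fun x y => x != y.

Lemma complete_adj_sym m : symmetric (@complete_adj m).
Proof. by move=> x y; rewrite /complete_adj eq_sym. Qed.

Lemma complete_adj_irrefl m : irreflexive (@complete_adj m).
Proof. by move=> x; rewrite /complete_adj eqxx. Qed.

Lemma complete_adj_connected m (x y : 'I_m) :
  exists2 p : seq 'I_m, path (@complete_adj m) x p & y = last x p.
Proof.
case: (eqVneq x y) => [->|xy]; first by exists [::].
by exists [:: y] => //=; rewrite /complete_adj xy.
Qed.

Definition complete_graph (m : nat) : sgraph :=
  SGraph (@complete_adj_sym m) (@complete_adj_irrefl m)
         (@complete_adj_connected m).

(* Main.v *)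
Require Import Defs.
From mathcomp Require Import all_boot all_order all_algebra.
From mathcomp Require Import reals.

Import Order.TTheory GRing.Theory Num.Theory.

(** Strict convexity is a discrete form of strict subharmonicity, and the
    obstruction is a maximum principle: at a vertex whose weight is at least
    that of each of its neighbours, no [n] neighbours can have an average
    exceeding the weight of the vertex ([local_max_not_strictly_convex]).  The
    vertex set of the complete graph is finite, so some vertex has maximal
    weight, and the remaining vertices are [n] neighbours of it
    ([complete_graph_neighbours]). *)

Local Open Scope ring_scope.

Lemma local_max_not_strictly_convex (R : realType) (n : nat) (G : wgraph R)
    (v : G) (s : n.-tuple G) :
  uniq s -> all (adj v) s -> (forall u, adj v u -> weight u <= weight v) ->
  ~ strictly_convex n G.
Proof.
move=> s_uniq s_adj v_max convG.
have v_deg : has_at_least_neighbours n v.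
  by exists s; rewrite ?s_uniq ?s_adj ?size_tuple.
have := convG v v_deg s s_uniq s_adj.
apply/negP; rewrite -leNgt.
have -> : n%:R * weight v = \sum_(u <- s) weight v.
  by rewrite big_const_seq count_predT size_tuple iter_addr_0 mulr_natl.
rewrite !big_seq; apply: ler_sum => u us.
exact/v_max/(allP s_adj).
Qed.

Lemma complete_graph_neighbours (n : nat) (v : complete_graph n.+1) :
  exists s : n.-tuple (complete_graph n.+1), uniq s && all (adj v) s.
Proof.
have s_size : size (enum (predC1 (v : 'I_n.+1))) == n.
  by rewrite -cardE cardC1 card_ord.
exists (Tuple s_size); rewrite /= enum_uniq.
by apply/allP => u; rewrite mem_enum inE eq_sym.
Qed.

Theorem corollary1p4 (R : realType) (n : nat) (n_gt0 : (0 < n)%N) :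
  ~ exists (w : complete_graph n.+1 -> R) (w_ge0 : forall v, 0 <= w v),
      strictly_convex n (WGraph w_ge0).
Proof.
move=> [w [w_ge0]].
have [v v_max] : exists v : 'I_n.+1, forall u : 'I_n.+1, w u <= w v.
  case: (arg_maxP (w : 'I_n.+1 -> R) (erefl (xpredT (@ord0 n)))) => v _ v_max.
  by exists v => u; apply: v_max.
have [s /andP[s_uniq s_adj]] := complete_graph_neighbours n v.
exact: (@local_max_not_strictly_convex R n (WGraph w_ge0) v s s_uniq s_adj (fun u _ => v_max u)).
Qed.
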